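(* Let $\beta>0$ and $\omega>0$, and consider the linear autonomous system $$x'=y,\qquad y'=-x-\frac{\beta}{\sqrt{\omega}}\,y .$$ Then: (i) the critical point $(x_{\mathrm{cr}},y_{\mathrm{cr}})=(0,0)$ is (linearly) asymptotically stable; (ii) the type of the critical point depends on the values of the parameters, i.e. there is a critical value of $\omega$, namely $\omega_*=\beta^2/4$, such that (a) for $\omega<\omega_*$ the critical point is a stable node; (b) for $\omega>\omega_*$ the critical point is a stable spiral; (c) for $\omega=\omega_*$ the critical point is a stable inflected node.
   Context: The prime denotes differentiation with respect to the independent variable $s$. The system is the linearization, about the critical point $(1/2,0)$, of $u'=v$, $v'=1-\frac{\beta}{\sqrt{\omega}}v-\sqrt{2u}$, with $x=u-1/2$, $y=v$. For a planar linear system with matrix $A$, the origin is a stable node if $A$ has two distinct negative real eigenvalues; a stable spiral if $A$ has a pair of non-real complex conjugate eigenvalues with negative real part; a stable inflected (degenerate, improper) node if $A$ has a repeated negative real eigenvalue whose eigenspace is one-dimensional. *)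

(* Defs.v *)
From HB Require Import structures.
From mathcomp Require Import all_boot all_order all_algebra.
From mathcomp Require Import all_classical all_reals all_analysis.
From mathcomp Require Import complex.

Set Implicit Arguments.
Unset Strict Implicit.
Unset Printing Implicit Defensive.

Import Order.TTheory GRing.Theory Num.Theory.
Import numFieldNormedType.Exports.

Local Open Scope classical_set_scope.
Local Open Scope ring_scope.

(* Linear autonomous systems z' = A z, with z a column vector. *)

(* Only the values of z on [0, +oo[ matter.  Solutions of a linear system never
   blow up in finite time, so stability can be phrased with global solutions. *)
Definition is_solution (R : realType) (n : nat) (A : 'M[R]_n.+1)
    (z : R -> 'cV[R]_n.+1) : Prop :=
  z @ 0^'+ --> z 0 /\ (forall t : R, 0 < t -> is_derive t 1 z (A *m z t)).

Definition critical_point (R : realType) (n : nat) (A : 'M[R]_n.+1)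
    (p : 'cV[R]_n.+1) : Prop :=
  A *m p = 0.

Definition lyapunov_stable (R : realType) (n : nat) (A : 'M[R]_n.+1)
    (p : 'cV[R]_n.+1) : Prop :=
  forall e : R, 0 < e -> exists2 d : R, 0 < d &
    forall z, is_solution A z -> `|z 0 - p| < d ->
      forall t : R, 0 <= t -> `|z t - p| < e.

Definition attractive (R : realType) (n : nat) (A : 'M[R]_n.+1)
    (p : 'cV[R]_n.+1) : Prop :=
  exists2 d : R, 0 < d &
    forall z, is_solution A z -> `|z 0 - p| < d -> z t @[t --> +oo] --> p.

Definition asymptotically_stable (R : realType) (n : nat) (A : 'M[R]_n.+1)
    (p : 'cV[R]_n.+1) : Prop :=
  lyapunov_stable A p /\ attractive A p.

(* MathComp's [eigenvalue] and [eigenspace] are about row vectors, hence the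
   transpositions: [eigenvalue A^T a] says that A *m v = a *: v for some nonzero
   column vector v. *)

Definition stable_node (R : realType) (A : 'M[R]_2) : Prop :=
  exists a b : R,
    [/\ a != b, a < 0, b < 0, eigenvalue A^T a & eigenvalue A^T b].

Definition stable_spiral (R : realType) (A : 'M[R]_2) : Prop :=
  let AC : 'M[R[i]]_2 := map_mx (real_complex R) A in
  exists a : R[i],
    [/\ complex.Im a != 0, complex.Re a < 0,
        eigenvalue AC^T a & eigenvalue AC^T (conjc a)].

Definition stable_inflected_node (R : realType) (A : 'M[R]_2) : Prop :=
  exists a : R,
    [/\ a < 0, mup a (char_poly A) = 2%N & \rank (eigenspace A^T a) = 1%N].

Definition col2 (R : realType) (x y : R) : 'cV[R]_2 :=
  \col_(i < 2) nth 0 [:: x; y] i.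

Definition system_mx (R : realType) (beta omega : R) : 'M[R]_2 :=
  \matrix_(i < 2, j < 2)
    nth 0 (nth [::] [:: [:: 0; 1]; [:: -1; - (beta / Num.sqrt omega)]] i) j.

Lemma system_mxE (R : realType) (beta omega x y : R) :
  system_mx beta omega *m col2 x y
  = col2 y (- x - beta / Num.sqrt omega * y).
Proof.
apply/colP => i; rewrite !mxE !big_ord_recl big_ord0 !mxE /= addr0.
case: i => [[|[|//]] ?] /=; first by rewrite mul0r mul1r add0r.
by rewrite mulN1r mulNr.
Qed.

(* Main.v *)
Require Import Defs.
From HB Require Import structures.
From mathcomp Require Import all_boot all_order all_algebra.
From mathcomp Require Import all_classical all_reals all_analysis.
From mathcomp Require Import complex.
From mathcomp Require Import ring lra.

(** Write k = beta / sqrt omega, so that the system is x' = y, y' = - x - k y.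

    Stability rests on the Lyapunov function
    V = (k x + y)^2 + 2 x^2 + y^2, whose derivative along the flow is
    - 2 k (x^2 + y^2).  As x^2 + y^2 <= V <= M (x^2 + y^2) with
    M = 2 k^2 + 3, this gives V' <= - c V with c = 2 k / M, whence
    V (t) <= V (0) exp (- c t): exp (c t) V (t) is nonincreasing
    ([exponential_decay]).  So every solution satisfies an exponential bound
    ([system_solution_decay]), which yields both Lyapunov stability and
    attractivity, uniformly over the three types of critical point.

    The type is read off the characteristic polynomial X^2 + k X + 1, of
    discriminant k^2 - 4, and k is compared with 2 exactly as beta^2 / 4 is
    with omega: two distinct roots (- k +/- sqrt (k^2 - 4)) / 2, negative
    since their product is 1 and their sum is - k, if k > 2; the conjugate
    pair (- k +/- i sqrt (4 - k^2)) / 2 if k < 2; and the double root - 1 if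
    k = 2, whose eigenspace is a line because A + I is not zero. *)
Import Order.TTheory GRing.Theory Num.Theory.
Import numFieldNormedType.Exports.

Local Open Scope classical_set_scope.
Local Open Scope ring_scope.

(** * The type of the critical point *)

Lemma char_poly_2x2 (F : comNzRingType) (A : 'M[F]_2) :
  char_poly A =
    'X^2 - (A 0 0 + A 1 1) *: 'X + (A 0 0 * A 1 1 - A 0 1 * A 1 0)%:P.
Proof.
have l00 : lift 0 0 = 1 :> 'I_2 by exact/val_inj.
have l10 : lift 1 0 = 0 :> 'I_2 by exact/val_inj.
rewrite /char_poly (expand_det_row _ 0) !big_ord_recl big_ord0 /cofactor.
rewrite !det_mx11 !mxE /= !l00 !l10 /= -mul_polyC polyCB polyCD !polyCM.
ring.
Qed.

(** The transposition does not affect the criterion; it only makes a an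
    eigenvalue for column vectors. *)
Lemma eigenvalue_tr_2x2 (F : fieldType) (A : 'M[F]_2) (a : F) :
  eigenvalue A^T a =
    (a ^+ 2 - (A 0 0 + A 1 1) * a + (A 0 0 * A 1 1 - A 0 1 * A 1 0) == 0).
Proof.
by rewrite eigenvalue_root_char char_poly_2x2 /root !hornerE !mxE
  (mulrC (A 1 0)).
Qed.

Section PhasePortrait.
Context (R : realType) (beta omega : R).
Let k := beta / Num.sqrt omega.

Lemma char_poly_system_mx :
  char_poly (system_mx beta omega) = 'X^2 + k *: 'X + 1.
Proof.
by rewrite char_poly_2x2 !mxE /= add0r scaleNr opprK mul0r mulrN1 opprK add0r.
Qed.

Lemma eigenvalue_system_mx (a : R) :
  eigenvalue (system_mx beta omega)^T a = (a ^+ 2 + k * a + 1 == 0).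
Proof.
by rewrite eigenvalue_tr_2x2 !mxE /= add0r mulNr opprK mul0r mulrN1 opprK add0r.
Qed.

Lemma eigenvalue_complex_system_mx (a : R[i]) :
  eigenvalue (map_mx (real_complex R) (system_mx beta omega))^T a =
    (a ^+ 2 + k%:C%C * a + 1 == 0).
Proof.
rewrite eigenvalue_tr_2x2 !mxE /= !(rmorph0, rmorph1, rmorphN).
by rewrite add0r mulNr opprK mul0r mulrN1 opprK add0r.
Qed.

Lemma stable_node_system_mx : 2 < k -> stable_node (system_mx beta omega).
Proof.
move=> k2; pose s := Num.sqrt (k ^+ 2 - 4).
have s2 : s ^+ 2 = k ^+ 2 - 4 by rewrite sqr_sqrtr //; nra.
have s0 : 0 < s by rewrite sqrtr_gt0; nra.
exists ((- k + s) / 2), ((- k - s) / 2); rewrite !eigenvalue_system_mx; split.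
- by apply/eqP; lra.
- by nra.
- by lra.
- by apply/eqP; transitivity ((s ^+ 2 - (k ^+ 2 - 4)) / 4);
    [field|rewrite s2 subrr mul0r].
- by apply/eqP; transitivity ((s ^+ 2 - (k ^+ 2 - 4)) / 4);
    [field|rewrite s2 subrr mul0r].
Qed.

Lemma stable_spiral_system_mx :
  0 < k -> k < 2 -> stable_spiral (system_mx beta omega).
Proof.
move=> k0 k2; pose s := Num.sqrt (4 - k ^+ 2).
have s2 : s ^+ 2 = 4 - k ^+ 2 by rewrite sqr_sqrtr //; nra.
have s0 : 0 < s by rewrite sqrtr_gt0; nra.
have root_im (y : R) : y ^+ 2 = s ^+ 2 / 4 ->
    eigenvalue (map_mx (real_complex R) (system_mx beta omega))^T
      ((- k / 2) +i* y)%C.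
  move=> y2; rewrite eigenvalue_complex_system_mx expr2 eq_complex /=.
  rewrite -[y * y]expr2 y2 s2; apply/andP; split; apply/eqP;
    by field.
exists ((- k / 2) +i* (s / 2))%C; split => /=.
- by apply/eqP; lra.
- by lra.
- by apply: root_im; field.
- by apply: root_im; field.
Qed.

Lemma stable_inflected_node_system_mx :
  k = 2 -> stable_inflected_node (system_mx beta omega).
Proof.
move=> k2; exists (-1); split; first by lra.
  have -> : char_poly (system_mx beta omega) = ('X - (-1)%:P) ^+ 2.
    by rewrite char_poly_system_mx k2 -mul_polyC polyCN; ring.
  by rewrite mup_XsubCX eqxx.
apply/eqP; rewrite eqn_leq; apply/andP; split; last first.
  rewrite lt0n mxrank_eq0.
  have := eigenvalue_system_mx (-1); rewrite /eigenvalue k2 => ->.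
  by apply/eqP; ring.
rewrite /eigenspace mxrank_ker leq_subLR -[2%N]/(1 + 1)%N leq_add2r lt0n.
rewrite mxrank_eq0.
(* the off-diagonal entry 1, from x' = y, is not affected by a%:M *)
apply/eqP => /matrixP /(_ 1 0); rewrite !mxE /= mulr0n subr0.
by apply/eqP; rewrite oner_eq0.
Qed.

End PhasePortrait.

(** * Asymptotic stability *)

Lemma is_derive_coord (R : realFieldType) (V : normedModType R) (m n : nat)
    (M : V -> 'M[R]_(m, n)) (t v : V) (D : 'M[R]_(m, n)) i j :
  is_derive t v M D -> is_derive t v (fun s => M s i j) (D i j).
Proof.
move=> [dM <-]; split; first exact: (derivable_mxP M t v).1.
by rewrite derive_mx // mxE.
Qed.

(** Differential inequality of Gronwall type, for a function that is only
    right continuous at 0. *)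
Lemma exponential_decay (R : realType) (V dV : R -> R) (c : R) :
  V @ 0^'+ --> V 0 -> (forall t : R, 0 < t -> is_derive t 1 V (dV t)) ->
  (forall t : R, 0 < t -> dV t <= - c * V t) ->
  forall t : R, 0 <= t -> V t <= V 0 * expR (- (c * t)).
Proof.
move=> V0 derV leV t t0.
pose W s := expR (c * s) * V s.
have derW (s : R) : 0 < s -> is_derive s 1 W (expR (c * s) * (dV s + c * V s)).
  move=> s0; have := derV s s0 => dVs.
  have dE : is_derive s 1 (fun s => expR (c * s)) (expR (c * s) * c).
    apply: (@is_derive1_comp _ expR ( *%R c)).
    by apply: is_derive_eq; rewrite /GRing.scale /= mulr1.
  apply: (@is_derive_eq _ _ _ (fun s => expR (c * s) * V s)).
  by rewrite /GRing.scale /=; ring.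
have contE s : {for s, continuous (fun s => expR (c * s))}.
  apply: (@continuous_comp _ _ _ ( *%R c) expR); last exact: continuous_expR.
  exact: mulrl_continuous.
suff WtW0 : W t <= W 0.
  rewrite expRN ler_pdivlMr ?expR_gt0 //.
  by move: WtW0; rewrite /W mulr0 expR0 mul1r mulrC.
apply: (@ler0_derive1_nincry _ W 0) => //.
- by move=> s; rewrite in_itv /= andbT => /derW[].
- move=> s; rewrite in_itv /= andbT => s0.
  have dWs := derW s s0; rewrite derive1E derive_val.
  rewrite pmulr_rle0 ?expR_gt0 //; have := leV s s0; lra.
- apply/continuous_within_itvcyP; split.
    move=> s; rewrite in_itv /= andbT => /derW[dWs _].
    by apply: differentiable_continuous; apply/derivable1_diffP.
  apply: cvgM V0; apply: cvg_at_right_filter; exact: contE.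
Qed.

Lemma is_derive_lyapunov (R : realType) (k : R) (x y : R -> R) (s dx dy : R) :
  is_derive s 1 x dx -> is_derive s 1 y dy ->
  is_derive s 1 (fun s => (k * x s + y s) ^+ 2 + 2 * x s ^+ 2 + y s ^+ 2)
    (2 * (k * x s + y s) * (k * dx + dy) + 4 * x s * dx + 2 * y s * dy).
Proof.
move=> dxs dys.
have du := is_deriveX 2 (is_deriveD (is_deriveZ k dxs) dys).
have dV := is_deriveD (is_deriveD du (is_deriveZ 2 (is_deriveX 2 dxs)))
             (is_deriveX 2 dys).
apply: (@is_derive_eq _ _ _ _ _ _ _ _ dV).
(* unfold the pointwise operations on functions *)
change (2 * (k * x s + y s) ^+ 1 * (k * dx + dy) + 2 * (2 * x s ^+ 1 * dx) +
    2 * y s ^+ 1 * dy = 2 * (k * x s + y s) * (k * dx + dy) + 4 * x s * dx +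
    2 * y s * dy).
ring.
Qed.

Lemma normr_coord_le (R : realDomainType) (m n : nat) (M : 'M[R]_(m, n)) i j :
  `|M i j| <= mx_norm M.
Proof. by rewrite mx_normrE; exact: (le_bigmax _ _ (i, j)). Qed.

Lemma sqr_norm_cV2_le (R : realType) (z : 'cV[R]_2) :
  `|z| ^+ 2 <= z 0 0 ^+ 2 + z 1 0 ^+ 2.
Proof.
rewrite [`|z|]/Num.norm /=.
have [->|/mx_norm_neq0[[i j] /= ->]] := eqVneq (mx_norm z) 0.
  by rewrite expr0n /= addr_ge0 // sqr_ge0.
rewrite (ord1 j) real_normK ?num_real //.
have := sqr_ge0 (z 0 0); have := sqr_ge0 (z 1 0).
case: i => [[|[|//]] lti].
  by rewrite (_ : Ordinal lti = 0); [lra|exact/val_inj].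
by rewrite (_ : Ordinal lti = 1); [lra|exact/val_inj].
Qed.

Section Stability.
Context (R : realType) (beta omega : R).
Let k := beta / Num.sqrt omega.
Context (k_gt0 : 0 < k).

(** Up to a constant factor, the quadratic form z^T P z with P solving the
    Lyapunov equation A^T P + P A = - I. *)
Definition lyapunov_fun (z : 'cV[R]_2) : R :=
  (k * z 0 0 + z 1 0) ^+ 2 + 2 * z 0 0 ^+ 2 + z 1 0 ^+ 2.

(* lyapunov_fun z <= M * (x ^+ 2 + y ^+ 2) *)
Let M := 2 * k ^+ 2 + 3.

(** The factor 2 comes from comparing the maximum norm of column vectors with
    the Euclidean one. *)
Lemma system_solution_decay (z : R -> 'cV[R]_2) :
  is_solution (system_mx beta omega) z ->
  forall t, 0 <= t ->
    `|z t| ^+ 2 <= 2 * M * `|z 0| ^+ 2 * expR (- (2 * k / M * t)).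
Proof.
move=> [z0 dz] t t0.
have M0 : 0 < M by rewrite /M; have := sqr_ge0 k; lra.
have Vlo u : `|u| ^+ 2 <= lyapunov_fun u.
  apply: le_trans (sqr_norm_cV2_le _ u) _; rewrite /lyapunov_fun.
  have := sqr_ge0 (k * u 0 0 + u 1 0); have := sqr_ge0 (u 0 0); lra.
have Vup u : lyapunov_fun u <= M * (u 0 0 ^+ 2 + u 1 0 ^+ 2).
  rewrite /lyapunov_fun /M -subr_ge0.
  have -> : (2 * k ^+ 2 + 3) * (u 0 0 ^+ 2 + u 1 0 ^+ 2) -
      ((k * u 0 0 + u 1 0) ^+ 2 + 2 * u 0 0 ^+ 2 + u 1 0 ^+ 2) =
      (k * u 0 0 - u 1 0) ^+ 2 + u 0 0 ^+ 2 + 2 * (k * u 1 0) ^+ 2 by ring.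
  have := sqr_ge0 (k * u 0 0 - u 1 0); have := sqr_ge0 (u 0 0).
  have := sqr_ge0 (k * u 1 0); lra.
have cz i : (fun s => z s i 0) @ 0^'+ --> z 0 i 0.
  by apply: (cvg_comp z (fun u : 'cV_2 => u i 0)) z0 _; exact: coord_continuous.
pose dV s := - (2 * k) * (z s 0 0 ^+ 2 + z s 1 0 ^+ 2).
have := @exponential_decay R (lyapunov_fun \o z) dV (2 * k / M) _ _ _ t t0.
move=> decay; apply: le_trans (Vlo _) (le_trans (decay _ _ _) _) => {decay}.
- have sq (f : R -> R) (l : R) : f @ 0^'+ --> l ->
      (fun s => f s ^+ 2) @ 0^'+ --> l ^+ 2.
    move=> fl; apply: (@cvg_comp _ _ _ f (fun x => x ^+ 2)) fl _.
    exact: exprn_continuous.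
  apply: cvgD (sq _ _ (cz 1)); apply: cvgD;
    last exact: cvgMl_tmp (sq _ _ (cz 0)).
  apply: (sq (fun s => k * z s 0 0 + z s 1 0)).
  exact: cvgD (cvgMl_tmp (cz 0)) (cz 1).
- move=> s s0; have dzs := dz s s0.
  have dx := @is_derive_coord _ _ _ _ _ _ _ _ 0 0 dzs.
  have dy := @is_derive_coord _ _ _ _ _ _ _ _ 1 0 dzs.
  move: dx dy; rewrite !mxE !big_ord_recl !big_ord0 !mxE /= -/k.
  have -> : lift 0 0 = 1 :> 'I_2 by exact/val_inj.
  set x := fun s => z s 0 0; set y := fun s => z s 1 0 => dx dy.
  have dLV := @is_derive_lyapunov R k x y s _ _ dx dy.
  have <- : 2 * (k * x s + y s) *
         (k * (0 * x s + (1 * y s + 0)) + (-1 * x s + (- k * y s + 0))) +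
       4 * x s * (0 * x s + (1 * y s + 0)) +
       2 * y s * (-1 * x s + (- k * y s + 0)) = dV s.
    by rewrite /dV -/(x s) -/(y s); ring.
  exact: dLV.
- have k2_ge0 : 0 <= 2 * k by apply: mulr_ge0 => //; exact: ltW.
  move=> s _; rewrite /dV /= !mulNr lerN2 -(mulrA (2 * k)) ler_wpM2l //.
  by rewrite ler_pdivrMl.
apply: ler_wpM2r; first exact: expR_ge0.
apply: le_trans (Vup _) _; rewrite -mulrA mulrCA ler_pM2l //.
have sq i : z 0 i 0 ^+ 2 <= `|z 0| ^+ 2.
  by rewrite -[leLHS]real_normK ?num_real // lerXn2r ?nnegrE // normr_coord_le.
by rewrite mulr_natl mulr2n lerD.
Qed.

Lemma asymptotically_stable_system_mx :
  asymptotically_stable (system_mx beta omega) 0.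
Proof.
have M3 : 3 <= M by rewrite /M; have := sqr_ge0 k; lra.
have c0 : 0 < 2 * k / M by apply: divr_gt0; [exact: mulr_gt0|lra].
split=> [e e0|].
  (* 2 * M >= 1 dominates its own square root, so d needs no root *)
  exists (e / (2 * M)) => [|z sol]; first by rewrite divr_gt0 //; lra.
  rewrite subr0 ltr_pdivlMr => [z0e t t0|]; last by lra.
  rewrite subr0 -(ltr_pXn2r (n:=2)) ?nnegrE ?(ltW e0) //.
  apply: le_lt_trans (system_solution_decay _ sol t t0) _.
  have eR1 : expR (- (2 * k / M * t)) <= 1.
    by rewrite expR_le1 oppr_le0 mulr_ge0 // ltW.
  apply: (@le_lt_trans _ _ (2 * M * `|z 0| ^+ 2)).
    by rewrite ler_piMr // mulr_ge0 ?sqr_ge0 //; lra.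
  have := normr_ge0 (z 0) => n0.
  apply: (@le_lt_trans _ _ ((`|z 0| * (2 * M)) ^+ 2)).
    have -> : (`|z 0| * (2 * M)) ^+ 2 = 2 * M * `|z 0| ^+ 2 * (2 * M) by ring.
    by rewrite ler_peMr ?mulr_ge0 ?sqr_ge0 //; lra.
  by rewrite ltr_pXn2r ?nnegrE ?(ltW e0) // mulr_ge0 //; lra.
exists 1 => // z sol _; apply/cvgrPdist_lt => e e0.
have lim0 : 2 * M * `|z 0| ^+ 2 * expR (- (2 * k / M * t)) @[t --> +oo] --> 0.
  rewrite -[X in _ --> X](mulr0 (2 * M * `|z 0| ^+ 2)); apply: cvgMl_tmp.
  apply: (@cvg_comp _ _ _ ( *%R (2 * k / M)) (fun x => expR (- x)));
    last exact: cvgr_expR.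
  exact: (gt0_cvgMry c0 cvg_id).
near=> t; rewrite sub0r normrN -(ltr_pXn2r (n:=2)) ?nnegrE ?(ltW e0) //.
apply: le_lt_trans (system_solution_decay _ sol t _) _.
  by near: t; exact: nbhs_pinfty_ge.
near: t; apply: (cvgr_lt 0) => //; exact: exprn_gt0.
Unshelve. all: by end_near. Qed.

End Stability.

Theorem theorem5p1 (R : realType) (beta : R) (hbeta : 0 < beta) :
  (forall omega : R, 0 < omega ->
     critical_point (system_mx beta omega) (col2 0 0) /\
     asymptotically_stable (system_mx beta omega) (col2 0 0)) /\
  (exists2 omega_star : R, omega_star = beta ^+ 2 / 4 &
     forall omega : R, 0 < omega ->
       [/\ omega < omega_star -> stable_node (system_mx beta omega),
           omega_star < omega -> stable_spiral (system_mx beta omega)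
         & omega = omega_star ->
             stable_inflected_node (system_mx beta omega)]).
Proof.
have k_gt0 omega : 0 < omega -> 0 < beta / Num.sqrt omega.
  by move=> w0; rewrite divr_gt0 // sqrtr_gt0.
split=> [omega w0|].
  have -> : col2 0 0 = 0 :> 'cV[R]_2.
    by apply/colP => i; rewrite !mxE; case: i => [[|[|//]] ?].
  split; first exact: mulmx0.
  exact/asymptotically_stable_system_mx/k_gt0.
exists (beta ^+ 2 / 4) => // omega w0.
have s0 : 0 < Num.sqrt omega by rewrite sqrtr_gt0.
have : Num.sqrt omega ^+ 2 = omega by rewrite sqr_sqrtr // ltW.
set s := Num.sqrt omega in s0 * => s2.
split=> h.
- by apply: stable_node_system_mx; rewrite -/s ltr_pdivlMr //; nra.
- apply: stable_spiral_system_mx; first exact: k_gt0.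
  by rewrite -/s ltr_pdivrMr //; nra.
- apply: stable_inflected_node_system_mx; rewrite -/s.
  have -> : beta = 2 * s by nra.
  by rewrite mulfK // gt_eqF.
Qed.
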